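(* Let $n,p,s$ be positive integers, let $A\in\mathbb{C}^{n\times n}$, let $v_0,v_1,\dots,v_p\in\mathbb{C}^n$, and set $$V=\begin{bmatrix} v_0 & v_p & v_{p-1} & \cdots & v_1\end{bmatrix}\in\mathbb{C}^{n\times(p+1)},\qquad J=[0]\oplus J_p(0)\in\mathbb{C}^{(p+1)\times(p+1)}.$$ Define $$D_1=V/s,\qquad D_k=(A/s)\,D_{k-1}+D_1\,(J/s)^{k-1}\quad (k\ge 2),\qquad S=\sum_{k=1}^{\infty}\frac{D_k}{k!}.$$ Then the recurrence $$F_1=S,\qquad F_{k+1}=\mathrm{e}^{A/s}F_k+S\,\mathrm{e}^{kJ/s},\qquad k=1,\dots,s-1,$$ yields $$F_s=\begin{bmatrix}\varphi_1(A)v_0 & \varphi_1(A)v_p & \varphi_1(A)v_{p-1}+\varphi_2(A)v_p & \cdots & \sum_{k=1}^{p}\varphi_k(A)v_k\end{bmatrix},$$ that is, the first column of $F_s$ is $F_s(:,1)=\varphi_1(A)v_0$, and for $2\le j\le p+1$ the $j$th column of $F_s$ is $$F_s(:,j)=\sum_{k=1}^{j-1}\varphi_k(A)\,v_{p-j+k+1}.$$ Consequently, $\mathrm{e}^{A}v_0=A\,F_s(:,1)+v_0$.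
   Context: For a square complex matrix $X$, $\varphi_0(X)=\mathrm{e}^{X}$ and $\varphi_j(X)=\sum_{k=0}^{\infty}\frac{X^k}{(k+j)!}$ for integers $j\ge 1$. $J_p(0)\in\mathbb{C}^{p\times p}$ denotes the (upper triangular) Jordan block with eigenvalue $0$, i.e. the matrix with ones on the first superdiagonal and zeros elsewhere. $[0]\oplus J_p(0)$ is the block diagonal matrix with the $1\times1$ zero block followed by $J_p(0)$. $F(:,j)$ denotes the $j$th column of a matrix $F$, with columns indexed from $1$. *)

(* Defs.v *)
From HB Require Import structures.
From mathcomp Require Import all_boot all_order all_algebra.
From mathcomp Require Import all_classical all_reals all_analysis.
From mathcomp.real_closed Require Import complex.

Set Implicit Arguments.
Unset Strict Implicit.
Unset Printing Implicit Defensive.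

Import Order.TTheory GRing.Theory Num.Theory numFieldNormedType.Exports.
Local Open Scope ring_scope.
Local Open Scope complex_scope.

(* The library attaches the topology of the modulus to an abstract
   numFieldType only; here it is made available on the concrete carrier R[i],
   so that matrices over R[i] get their (entrywise, equivalently max-norm)
   topology. *)
HB.instance Definition _ (R : realType) := NormedModule.copy R[i] (R[i])^o.

Section MatrixFunctions.
Variables (R : realType) (n : nat).
Implicit Type X : 'M[R[i]]_n.

Definition expmx X : 'M[R[i]]_n :=
  limn (series (fun k => (k`!)%:R^-1 *: X ^+ k)).

Definition phimx (j : nat) X : 'M[R[i]]_n :=
  if j is 0 then expmx X
  else limn (series (fun k => ((k + j)`!)%:R^-1 *: X ^+ k)).

End MatrixFunctions.

Definition jordan_block (K : pzRingType) (p : nat) (a : K) : 'M[K]_p :=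
  \matrix_(i, j) (a *+ (i == j) + (i.+1 == j :> nat)%:R).

Definition Jmx (R : realType) (p : nat) : 'M[R[i]]_(1 + p) :=
  block_mx 0 0 0 (jordan_block p 0).

(* [ v_0 v_p v_{p-1} ... v_1 ]; in the right block, column j (counted from 0)
   is v_{p-j}. *)
Definition Vmx (R : realType) (n p : nat) (v : 'I_p.+1 -> 'cV[R[i]]_n) :
    'M[R[i]]_(n, 1 + p) :=
  row_mx (v ord0) (\matrix_(i < n, j < p) v (inord (p - j)) i 0).

(* Main.v *)
Require Import Defs.
From HB Require Import structures.
From mathcomp Require Import all_boot all_order all_algebra.
From mathcomp Require Import all_classical all_reals all_analysis.
From mathcomp.real_closed Require Import complex.
From mathcomp Require Import zify.
Import Order.TTheory GRing.Theory Num.Theory numFieldNormedType.Exports.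
Local Open Scope classical_set_scope.
Local Open Scope ring_scope.
Local Open Scope complex_scope.

(* With h = 1/s and M = [[A, V], [0, J]], the matrix D_k is the upper right
   block of (h M)^k, hence S is the upper right block of exp(h M).  The
   recurrence is the block form of exp((k+1) h M) = exp(h M) exp(k h M), so F_s
   is the upper right block of exp(M).  The upper right block U_k of M^k
   satisfies U_{k+1} = A^k V + U_k J, and right multiplication by J shifts
   columns; summing with weights 1/(k+1)! column by column produces the
   phi-functions. *)

(** * Entrywise convergence of matrices and series in [R[i]] *)

(** Neighbourhoods of a matrix are generated by families of entrywise neighbourhoods, and as there
    are finitely many entries, finitely many eventual conditions hold simultaneously. *)
Lemma cvg_mxP (T : topologicalType) m n (u : nat -> 'M[T]_(m, n)) (l : 'M[T]_(m, n)) :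
  u @ \oo --> l <-> forall i j, u k i j @[k --> \oo] --> l i j.
Proof.
split=> [ul i j P lP | ul P [Q lQ QP]].
  apply: (ul [set M : 'M[T]_(m, n) | P (M i j)]).
  (* The family constraining only the entry [(i, j)]. *)
  pose W a b : set T := if (a == i) && (b == j) then P else setT.
  exists W => [a b|M /(_ i j)]; last by rewrite /W !eqxx.
  by rewrite /W; case: ifP => [/andP[/eqP-> /eqP->]//|_]; exact: filterT.
have H i j : \forall k \near \oo, Q i j (u k i j) by move: (Q i j) (lQ i j); exact: ul.
have : \forall k \near \oo, forall i j, Q i j (u k i j).
  by apply: filter_forall => i; apply: filter_forall => j; exact: H.
by apply: filterS => k; exact: QP.
Qed.

Lemma cvg_complex (R : realType) (u : nat -> R[i]) (a b : R) :
  complex.Re (u k) @[k --> \oo] --> a -> complex.Im (u k) @[k --> \oo] --> b ->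
  u @ \oo --> a +i* b.
Proof.
move=> ua ub; apply/cvgrPdist_lt => -[e e']; rewrite ltcE /= => /andP[/eqP-> e0].
have e2 : 0 < e / 2 by rewrite divr_gt0.
move/cvgrPdist_lt : ua => /(_ _ e2) ua; move/cvgrPdist_lt : ub => /(_ _ e2) ub.
near=> k.
have -> : a +i* b - u k = (a - complex.Re (u k))%:C + 'i%C * (b - complex.Im (u k))%:C.
  by case: (u k) => x y; simpc.
rewrite (le_lt_trans (ler_normD _ _))// normrM !normc_def /=.
rewrite !expr0n !expr1n /= add0r !addr0 sqrtr1 !sqrtr_sqr mul1r -rmorphD/= ltcR.
rewrite [e]splitr ltrD//; near: k; [exact: ua | exact: ub].
Unshelve. all: by end_near. Qed.

Lemma cvg_real_complex (R : realType) (u : nat -> R) (a : R) :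
  u @ \oo --> a -> (u k)%:C @[k --> \oo] --> a%:C.
Proof. by move=> ua; apply: cvg_complex => //=; exact: cvg_cst. Qed.

Lemma cvg0_le_complex (R : realType) (u : nat -> R[i]) (r : nat -> R) :
  (forall k, `|u k| <= (r k)%:C) -> r @ \oo --> 0 -> u @ \oo --> 0.
Proof.
move=> ur r0; apply/cvgr0Pnorm_lt => e e0.
have /cvgr0Pnorm_lt/(_ e e0) : (r k)%:C @[k --> \oo] --> (0 : R)%:C.
  exact: cvg_real_complex.
apply: filterS => k; apply: le_lt_trans; rewrite (le_trans (ur k))// ger0_norm//.
exact: le_trans (ur k).
Qed.

(** Real and imaginary parts are bounded by the modulus, so the real comparison test applies to
    each, and the two limits recombine. *)
Lemma is_cvg_series_le_complex (R : realType) (u : nat -> R[i]) (r : nat -> R) :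
  (forall k, `|u k| <= (r k)%:C) -> cvgn (series r) -> cvgn (series u).
Proof.
move=> ur rcv.
have r0 k : 0 <= r k by rewrite -ler0c (le_trans _ (ur k)).
have cvf (f : R[i] -> R) : {morph f : x y / x + y} -> f 0 = 0 ->
    (forall x, `|f x|%:C <= `|x|) ->
    f (series u N) @[N --> \oo] --> limn (series (f \o u)).
  move=> fD f0 fle.
  have -> : (fun N => f (series u N)) = series (f \o u).
    by apply/funext => N; exact: (big_morph f fD f0).
  apply: normed_cvg; apply: series_le_cvg rcv => // k /=; first exact: normr_ge0.
  by rewrite -lecR (le_trans (fle _)).
apply/cvg_ex; exists (limn (series (@complex.Re R \o u))
  +i* limn (series (@complex.Im R \o u))).
apply: cvg_complex; apply: cvf => //; [by case=> ? ? []| |by case=> ? ? []|].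
  exact: normc_ge_Re.
case=> x y; rewrite normc_def lecR /= -(sqrtr_sqr y) ler_sqrt ?addr_ge0 ?sqr_ge0//.
by rewrite lerDr sqr_ge0.
Qed.

(** * Convergence of matrix power series and the exponential of a sum *)

(** Finite form of the Cauchy product: the first sum on the right runs along the antidiagonals of
    the square, the second is the remaining corner, to be shown negligible. *)
Lemma sum_square_triangle (V : nmodType) N (g : nat -> nat -> V) :
  \sum_(0 <= i < N) \sum_(0 <= j < N) g j i =
  \sum_(0 <= m < N) \sum_(i < m.+1) g (m - i)%N i
  + \sum_(0 <= i < N) \sum_(N - i <= j < N) g j i.
Proof.
have -> : \sum_(0 <= m < N) \sum_(i < m.+1) g (m - i)%N i =
    \sum_(0 <= i < N) \sum_(0 <= j < N - i) g j i.
  (* Passing from [N] to [N.+1] lengthens each row of the triangle by one term; together these form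
     the antidiagonal [m = N]. *)
  elim: N => [|N IH]; first by rewrite !big_geq.
  rewrite big_nat_recr//= IH -(big_mkord predT (fun i => g (N - i)%N i)).
  rewrite [in RHS]big_nat_recr//= [in LHS]big_nat_recr//= addrA -big_split/=.
  rewrite subSnn subnn big_nat1; congr (_ + _).
  by apply: eq_big_nat => i iN; rewrite subSn 1?ltnW// big_nat_recr.
rewrite -big_split/=; apply: eq_big_nat => i _.
by rewrite -big_cat_nat// leq_subr.
Qed.

Lemma natr_bin_fact (K : numFieldType) m i : (i < m.+1)%N ->
  (m`!)%:R^-1 *+ 'C(m, i) = ((m - i)`!)%:R^-1 * (i`!)%:R^-1 :> K.
Proof.
move=> im; rewrite -(@bin_fact m i)// !natrM !invfM -[LHS]mulr_natl.
rewrite mulVKf 1?[LHS]mulrC//.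
by rewrite pnatr_eq0 -lt0n bin_gt0.
Qed.

(* The entrywise 1-norm b(M) satisfies |(M N)_ij| <= b(M) max |N|, which avoids
   any dimension-dependent constant. *)
Lemma mulmx_expr_bound (R : realType) n (X Y : 'M[R[i]]_n) :
  exists x y : R, forall k l i j, `|(X ^+ k *m Y ^+ l) i j| <= (x ^+ k * y ^+ l)%:C.
Proof.
pose b (M : 'M[R[i]]_n) := \sum_i \sum_j `|M i j|.
have bR M : (complex.Re (b M))%:C = b M.
  by apply: RRe_real; apply: rpred_sum => i _; apply: rpred_sum => j _; exact: normr_real.
have b0 M : 0 <= b M by apply: sumr_ge0 => i _; apply: sumr_ge0.
have step (M N : 'M[R[i]]_n) c i j : 0 <= c -> (forall i j, `|N i j| <= c) ->
    `|(M *m N) i j| <= b M * c.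
  move=> c0 Nc; rewrite mxE (le_trans (ler_norm_sum _ _ _))//.
  rewrite (@le_trans _ _ (\sum_l (`|M i l| * c)))//.
    by apply: ler_sum => l _; rewrite normrM ler_wpM2l.
  (* The sum over row [i] is at most the sum over all rows. *)
  rewrite -mulr_suml ler_wpM2r// /b [leRHS](bigD1 i)//= lerDl.
  by apply: sumr_ge0 => ? _; apply: sumr_ge0.
have pow0 (M : 'M[R[i]]_n) k i j : `|(M ^+ k) i j| <= b M ^+ k.
  elim: k i j => [|k IH] i j.
    by rewrite !expr0 mxE; case: eqP; rewrite ?normr1 ?normr0.
  by rewrite !exprS -mulmxE; apply: step => //; exact: exprn_ge0.
exists (complex.Re (b X)), (complex.Re (b Y)) => k l i j.
rewrite rmorphM !rmorphXn /= !bR.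
elim: k i j => [|k IH] i j; first by rewrite !expr0 mul1mx mul1r.
by rewrite !exprS -mulmxE -mulmxA -mulrA; apply: step => //; rewrite mulr_ge0 ?exprn_ge0.
Qed.

(** Entries of [M ^+ k] grow at most like [x ^+ k], so each entry of the series is dominated by the
    real exponential series at [t * x]. *)
Lemma is_cvg_series_le_exp_mx (R : realType) n (M : 'M[R[i]]_n)
    (c : nat -> R[i]) (t : R) :
  (forall k, `|c k| <= (exp_coeff t k)%:C) ->
  cvgn (series (fun k => c k *: M ^+ k)).
Proof.
move=> ct; have [x [y xy]] := mulmx_expr_bound _ _ M M.
have cv i j : cvgn (series (fun k => (c k *: M ^+ k) i j)).
  apply: (@is_cvg_series_le_complex _ _ (exp_coeff (t * x))); last first.
    exact: is_cvg_series_exp_coeff.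
  move=> k; rewrite mxE normrM /exp_coeff /= exprMn mulrAC rmorphM/= ler_pM//.
  by have := xy k 0 i j; rewrite !expr0 mulmx1 mulr1.
apply/cvg_ex; exists (\matrix_(i, j) limn (series (fun k => (c k *: M ^+ k) i j))).
apply/cvg_mxP => i j; rewrite mxE.
have -> : (fun k => series (fun k => c k *: M ^+ k) k i j) =
    series (fun k => (c k *: M ^+ k) i j).
  by apply/funext => N; rewrite /series/= summxE.
exact: cv.
Qed.

Lemma cvg_phimx (R : realType) n (j : nat) (M : 'M[R[i]]_n) :
  series (fun k => ((k + j)`!)%:R^-1 *: M ^+ k) @ \oo --> phimx j M.
Proof.
have : cvgn (series (fun k => ((k + j)`!)%:R^-1 *: M ^+ k)).
  (* Since (k + j)! is at least k!, the exponential series at 1 dominates the weights. *)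
  apply: (@is_cvg_series_le_exp_mx _ _ _ _ 1) => k.
  rewrite ger0_norm ?invr_ge0// /exp_coeff/= expr1n mul1r fmorphV/= rmorph_nat.
  by rewrite lef_pV2 ?posrE ?ltr0n ?fact_gt0// ler_nat leq_fact// leq_addr.
case: j => [|j]; last by apply.
rewrite /= /expmx.
rewrite (_ : (fun k => ((k + 0)`!)%:R^-1 *: _) = (fun k => (k`!)%:R^-1 *: M ^+ k))//.
by apply/funext => k; rewrite addn0.
Qed.

Lemma cvg_expmx (R : realType) n (M : 'M[R[i]]_n) :
  series (fun k => (k`!)%:R^-1 *: M ^+ k) @ \oo --> expmx M.
Proof.
have := cvg_phimx _ _ 0 M.
rewrite (_ : (fun k => ((k + 0)`!)%:R^-1 *: _) = (fun k => (k`!)%:R^-1 *: M ^+ k))//.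
by apply/funext => k; rewrite addn0.
Qed.

Lemma cvg_mulmx (R : realType) m n p
    (u : nat -> 'M[R[i]]_(m, n)) (v : nat -> 'M[R[i]]_(n, p))
    (U : 'M[R[i]]_(m, n)) (V : 'M[R[i]]_(n, p)) :
  u @ \oo --> U -> v @ \oo --> V -> u k *m v k @[k --> \oo] --> U *m V.
Proof.
move=> /cvg_mxP uU /cvg_mxP vV; apply/cvg_mxP => i j; rewrite mxE.
under eq_fun do rewrite mxE.
apply: cvg_big => [|l _]; first exact: add_continuous.
exact: (cvgM (uU i l) (vV l j)).
Qed.

(* The corner i + j >= N of the square of summation is what exp(x) exp(y) has in
   excess of exp(x + y); it majorizes the same corner for matrices. *)
Lemma cvg0_sum_exp_coeff_corner (R : realType) (x y : R) :
  (\sum_(0 <= i < N) \sum_(N - i <= j < N) exp_coeff x j * exp_coeff y i)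
    @[N --> \oo] --> 0.
Proof.
have -> : (fun N => \sum_(0 <= i < N) \sum_(N - i <= j < N)
      exp_coeff x j * exp_coeff y i) =
    (fun N => series (exp_coeff x) N * series (exp_coeff y) N
      - series (exp_coeff (x + y)) N).
  apply/funext => N; apply/esym/eqP; rewrite subr_eq addrC /series/=; apply/eqP.
  rewrite mulr_sumr; under [LHS]eq_bigr do rewrite mulr_suml.
  rewrite (sum_square_triangle _ _ (fun j i => _ * _)); congr (_ + _).
  apply: eq_bigr => m _; rewrite /exp_coeff/= exprDn mulr_suml; apply: eq_bigr => i _.
  by rewrite mulrACA -natr_bin_fact// mulrnAl mulrnAr.
rewrite -[X in _ --> X](subrr (expR x * expR y)) -[in X in _ - X]expRD.
by apply: cvgB; [apply: cvgM|]; exact: is_cvg_series_exp_coeff.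
Qed.

(** The product of partial sums equals the partial sum for [X + Y] plus a corner. By
    [mulmx_expr_bound] the entries of the corner are dominated by the scalar corner, which tends to
    0, so one sequence has both sides as limits. *)
Lemma expmxD (R : realType) n (X Y : 'M[R[i]]_n) :
  comm_mx X Y -> expmx (X + Y) = expmx X *m expmx Y.
Proof.
move=> cXY; pose e (Z : 'M[R[i]]_n) := series (fun k => (k`!)%:R^-1 *: Z ^+ k).
pose g j i : 'M[R[i]]_n := ((j`!)%:R^-1 * (i`!)%:R^-1) *: (X ^+ j *m Y ^+ i).
have eE N : e X N *m e Y N =
    e (X + Y) N + \sum_(0 <= i < N) \sum_(N - i <= j < N) g j i.
  rewrite /e /series/= mulmx_sumr; under [LHS]eq_bigr do rewrite mulmx_suml.
  have -> : \sum_(0 <= i < N) \sum_(0 <= j < N)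
        (j`!%:R^-1 *: X ^+ j) *m (i`!%:R^-1 *: Y ^+ i) =
      \sum_(0 <= i < N) \sum_(0 <= j < N) g j i.
    apply: eq_bigr => i _; apply: eq_bigr => j _.
    by rewrite -scalemxAl -scalemxAr scalerA.
  rewrite sum_square_triangle; congr (_ + _).
  apply: eq_bigr => m _; rewrite exprDn_comm// scaler_sumr; apply: eq_bigr => i _.
  by rewrite /g -natr_bin_fact// -scalerMnr scalerMnl.
have [x [y xy]] := mulmx_expr_bound _ _ X Y.
have r0 : (\sum_(0 <= i < N) \sum_(N - i <= j < N) g j i) @[N --> \oo]
    --> (0 : 'M[R[i]]_n).
  apply/cvg_mxP => i j; rewrite mxE.
  apply: cvg0_le_complex (cvg0_sum_exp_coeff_corner _ x y) => N.
  rewrite summxE (le_trans (ler_norm_sum _ _ _))// rmorph_sum; apply: ler_sum => l _.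
  rewrite summxE (le_trans (ler_norm_sum _ _ _))//= rmorph_sum; apply: ler_sum => k _.
  rewrite mxE normrM ger0_norm ?mulr_ge0 ?invr_ge0//.
  rewrite /exp_coeff/= mulrACA mulrC rmorphM/= ler_pM ?mulr_ge0 ?invr_ge0//.
  by rewrite rmorphM !fmorphV !rmorph_nat.
have e1 : e X N *m e Y N @[N --> \oo] --> expmx X *m expmx Y.
  by apply: cvg_mulmx; exact: cvg_expmx.
have e2 : e X N *m e Y N @[N --> \oo] --> expmx (X + Y).
  rewrite -[X in _ --> X]addr0.
  have -> : (fun N => e X N *m e Y N) =
      (fun N => e (X + Y) N + \sum_(0 <= i < N) \sum_(N - i <= j < N) g j i).
    exact/funext.
  exact: (@cvgD _ 'M[R[i]]_n _ _ _ _ _ _ _ (cvg_expmx _ _ (X + Y)) r0).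
by rewrite -(norm_cvg_lim e1) -(norm_cvg_lim e2).
Qed.

(** * Powers and exponential of block upper triangular matrices *)

(** The upper right block is kept as an unevaluated [ursubmx]: only its two recurrences, obtained by
    splitting a factor off on the left or on the right, are used later. *)
Lemma expr_block_utri (K : comPzRingType) n m
    (A : 'M[K]_n) (V : 'M[K]_(n, m)) (J : 'M[K]_m) k :
  block_mx A V 0 J ^+ k =
  block_mx (A ^+ k) (ursubmx (block_mx A V 0 J ^+ k)) 0 (J ^+ k).
Proof.
elim: k => [|k IH].
  by rewrite !expr0 (scalar_mx_block n m 1 : 1 = _) block_mxKur.
rewrite !exprS IH -!mulmxE mulmx_block block_mxKur.
by rewrite !mul0mx !mulmx0 !addr0 add0r.
Qed.

Lemma ursubmx_block_expr0 (K : comPzRingType) n m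
    (A : 'M[K]_n) (V : 'M[K]_(n, m)) (J : 'M[K]_m) :
  ursubmx (block_mx A V 0 J ^+ 0) = 0.
Proof. by rewrite expr0 (scalar_mx_block n m 1 : 1 = _) block_mxKur. Qed.

(** Splitting off the left factor gives the recurrence that defines [D]. *)
Lemma ursubmx_block_exprS (K : comPzRingType) n m
    (A : 'M[K]_n) (V : 'M[K]_(n, m)) (J : 'M[K]_m) k :
  ursubmx (block_mx A V 0 J ^+ k.+1) =
  A *m ursubmx (block_mx A V 0 J ^+ k) + V *m J ^+ k.
Proof.
by rewrite exprS [in LHS]expr_block_utri -mulmxE mulmx_block block_mxKur.
Qed.

(** Splitting off the right factor makes [J] act on columns, which yields the column-by-column
    recurrence behind the phi-functions. *)
Lemma ursubmx_block_exprSr (K : comPzRingType) n m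
    (A : 'M[K]_n) (V : 'M[K]_(n, m)) (J : 'M[K]_m) k :
  ursubmx (block_mx A V 0 J ^+ k.+1) =
  A ^+ k *m V + ursubmx (block_mx A V 0 J ^+ k) *m J.
Proof.
by rewrite exprSr [in LHS]expr_block_utri -mulmxE mulmx_block block_mxKur.
Qed.

Lemma cvg_ursubmx_expmx (R : realType) n m (M : 'M[R[i]]_(n + m)) :
  series (fun k => (k`!)%:R^-1 *: ursubmx (M ^+ k)) @ \oo --> ursubmx (expmx M).
Proof.
have /cvg_mxP cM := cvg_expmx _ _ M; apply/cvg_mxP => i j; rewrite !mxE.
have -> : (fun N => series (fun k => (k`!)%:R^-1 *: ursubmx (M ^+ k)) N i j) =
    (fun N => series (fun k => (k`!)%:R^-1 *: M ^+ k) N (lshift m i) (rshift n j)).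
  by apply/funext => N; rewrite /series/= !summxE; apply: eq_bigr => k _; rewrite !mxE.
exact: cM.
Qed.

Lemma cvg_block_mx (T : topologicalType) m1 m2 n1 n2
    (ul : nat -> 'M[T]_(m1, n1)) (ur : nat -> 'M[T]_(m1, n2))
    (dl : nat -> 'M[T]_(m2, n1)) (dr : nat -> 'M[T]_(m2, n2))
    (Ul : 'M[T]_(m1, n1)) (Ur : 'M[T]_(m1, n2))
    (Dl : 'M[T]_(m2, n1)) (Dr : 'M[T]_(m2, n2)) :
  ul @ \oo --> Ul -> ur @ \oo --> Ur -> dl @ \oo --> Dl -> dr @ \oo --> Dr ->
  block_mx (ul k) (ur k) (dl k) (dr k) @[k --> \oo] --> block_mx Ul Ur Dl Dr.
Proof.
move=> /cvg_mxP cul /cvg_mxP cur /cvg_mxP cdl /cvg_mxP cdr; apply/cvg_mxP => i j.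
rewrite -(splitK i) -(splitK j);
case: (fintype.split i) => a; case: (fintype.split j) => b /=.
- rewrite block_mxEul (_ : (fun k => block_mx _ _ _ _ _ _) = fun k => ul k a b).
    exact: cul.
  by apply/funext => k; rewrite block_mxEul.
- rewrite block_mxEur (_ : (fun k => block_mx _ _ _ _ _ _) = fun k => ur k a b).
    exact: cur.
  by apply/funext => k; rewrite block_mxEur.
- rewrite block_mxEdl (_ : (fun k => block_mx _ _ _ _ _ _) = fun k => dl k a b).
    exact: cdl.
  by apply/funext => k; rewrite block_mxEdl.
- rewrite block_mxEdr (_ : (fun k => block_mx _ _ _ _ _ _) = fun k => dr k a b).
    exact: cdr.
  by apply/funext => k; rewrite block_mxEdr.
Qed.

Lemma expmx_block_utri (R : realType) n m
    (A : 'M[R[i]]_n) (V : 'M[R[i]]_(n, m)) (J : 'M[R[i]]_m) :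
  expmx (block_mx A V 0 J) =
  block_mx (expmx A) (ursubmx (expmx (block_mx A V 0 J))) 0 (expmx J).
Proof.
set M := block_mx A V 0 J.
rewrite -[LHS](norm_cvg_lim (cvg_expmx _ _ M)); apply: norm_cvg_lim.
have -> : series (fun k => (k`!)%:R^-1 *: M ^+ k) = fun N =>
    block_mx (series (fun k => (k`!)%:R^-1 *: A ^+ k) N)
             (series (fun k => (k`!)%:R^-1 *: ursubmx (M ^+ k)) N)
             0 (series (fun k => (k`!)%:R^-1 *: J ^+ k) N).
  apply/funext; rewrite /series/=; elim=> [|N IH]; first by rewrite !big_geq// block_mx0.
  rewrite !big_nat_recr//= IH [X in _ *: X]expr_block_utri -/M scale_block_mx scaler0.
  by rewrite add_block_mx addr0.
apply: cvg_block_mx;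
  [exact: cvg_expmx|exact: cvg_ursubmx_expmx|exact: cvg_cst|exact: cvg_expmx].
Qed.

(** * Series identities for the phi-functions *)

Lemma expmxE (R : realType) n (A : 'M[R[i]]_n) : expmx A = A *m phimx 1 A + 1%:M.
Proof.
have cA : (fun _ : nat => A) @ \oo --> A by exact: cvg_cst.
have cphi := cvg_mulmx _ _ _ _ _ _ _ _ cA (cvg_phimx _ _ 1 A).
rewrite -[LHS](norm_cvg_lim (cvg_expmx _ _ A)); apply: norm_cvg_lim.
(* The term k = 0 gives the identity matrix; one factor [A] comes out of every later term. *)
rewrite -cvg_shiftS.
have -> : (fun N => series (fun k => (k`!)%:R^-1 *: A ^+ k) N.+1) =
    (fun N => A *m series (fun k => ((k + 1)`!)%:R^-1 *: A ^+ k) N + 1%:M).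
  apply/funext => N; rewrite /series/= big_nat_recl// expr0 fact0 invr1 scale1r.
  rewrite addrC mulmx_sumr.
  by congr (_ + _); apply: eq_bigr => k _; rewrite -scalemxAr addn1 exprS.
exact: (@cvgD _ 'M[R[i]]_n _ _ _ _ _ _ _ cphi (cvg_cst _)).
Qed.

(* Summing the recurrence with weights 1/(k+q)! leaves the (c-1)-st sequence with
   weights 1/(k+q+1)!: hence the induction on c with q generalized. *)
Lemma cvg_phimx_chain (R : realType) n (A : 'M[R[i]]_n)
    (y : nat -> 'cV[R[i]]_n) (w : nat -> nat -> 'cV[R[i]]_n) (p : nat) :
  (forall c, w c 0 = 0) -> (forall k, w 0 k.+1 = A ^+ k *m y 0) ->
  (forall c k, (c.+1 < p)%N -> w c.+1 k.+1 = A ^+ k *m y c.+1 + w c k) ->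
  forall c q, (c < p)%N ->
  series (fun k => ((k + q)`!)%:R^-1 *: w c k.+1) @ \oo -->
    \sum_(l < c.+1) phimx (q + l) A *m y (c - l)%N.
Proof.
move=> w0 wS wSS.
have cphi q c : series (fun k => ((k + q)`!)%:R^-1 *: (A ^+ k *m y c)) @ \oo -->
    phimx q A *m y c.
  have cy : (fun _ : nat => y c) @ \oo --> y c by exact: cvg_cst.
  have -> : series (fun k => ((k + q)`!)%:R^-1 *: (A ^+ k *m y c)) =
      fun N => series (fun k => ((k + q)`!)%:R^-1 *: A ^+ k) N *m y c.
    apply/funext => N; rewrite /series/= mulmx_suml.
    by apply: eq_bigr => k _; rewrite -scalemxAl.
  exact: cvg_mulmx (cvg_phimx _ _ q A) cy.
elim=> [|c IH] q cp.
  rewrite big_ord1 addn0 subn0.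
  have -> : (fun k => ((k + q)`!)%:R^-1 *: w 0 k.+1) =
      (fun k => ((k + q)`!)%:R^-1 *: (A ^+ k *m y 0)).
    by apply/funext => k; rewrite wS.
  exact: cphi.
have {}IH := IH q.+1 (ltnW cp).
rewrite big_ord_recl addn0 subn0.
have -> : \sum_(l < c.+1) phimx (q + bump 0 l) A *m y (c.+1 - bump 0 l)%N =
    \sum_(l < c.+1) phimx (q.+1 + l) A *m y (c - l)%N.
  by apply: eq_bigr => l _; rewrite /bump /= add1n subSS addnS addSn.
have cw : series (fun k => ((k + q)`!)%:R^-1 *: w c k) @ \oo -->
    \sum_(l < c.+1) phimx (q.+1 + l) A *m y (c - l)%N.
  rewrite -cvg_shiftS.
  have -> : (fun N => series (fun k => ((k + q)`!)%:R^-1 *: w c k) N.+1) =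
      series (fun k => ((k + q.+1)`!)%:R^-1 *: w c k.+1).
    apply/funext => N; rewrite /series/= big_nat_recl// w0 scaler0 add0r.
    by apply: eq_bigr => k _; rewrite addnS addSn.
  exact: IH.
have -> : series (fun k => ((k + q)`!)%:R^-1 *: w c.+1 k.+1) = fun N =>
    series (fun k => ((k + q)`!)%:R^-1 *: (A ^+ k *m y c.+1)) N +
    series (fun k => ((k + q)`!)%:R^-1 *: w c k) N.
  apply/funext => N; rewrite /series/= -big_split/=.
  by apply: eq_bigr => k _; rewrite wSS// scalerDr.
exact: (@cvgD _ 'cV[R[i]]_n _ _ _ _ _ _ _ (cphi q c.+1) cw).
Qed.

(** * Columns of [Jmx] and [Vmx], counted from 0 *)

Lemma JmxE (R : realType) p (l j : 'I_(1 + p)) :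
  Jmx R p l j = ((0 < l)%N && (l.+1 == j :> nat))%:R.
Proof.
rewrite -(splitK l) -(splitK j) /Jmx.
case: (fintype.split l) => a; case: (fintype.split j) => b /=.
- by rewrite block_mxEul mxE ord1.
- by rewrite block_mxEur mxE ord1.
- by rewrite block_mxEdl mxE ord1.
- by rewrite block_mxEdr mxE mul0rn add0r add1n eqSS.
Qed.

(** Columns 0 and 1 of [Jmx R p] vanish: the former belongs to the zero block, the latter is the
    first column of the nilpotent Jordan block. *)
Lemma col_mulmx_Jmx_eq0 (R : realType) n p (X : 'M[R[i]]_(n, 1 + p)) (j : 'I_(1 + p)) :
  (j <= 1)%N -> col j (X *m Jmx R p) = 0.
Proof.
move=> j1; apply/colP => a; rewrite !mxE big1// => l _.
rewrite JmxE; case: ltngtP => //= l0; last by rewrite mulr0.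
by rewrite gtn_eqF ?mulr0// (leq_ltn_trans j1).
Qed.

(** The only nonzero entry in column [c.+2] of [Jmx R p] is the 1 in row [c.+1]. *)
Lemma col_mulmx_Jmx (R : realType) n p (X : 'M[R[i]]_(n, 1 + p)) c : (c.+1 < p)%N ->
  col (inord c.+2) (X *m Jmx R p) = col (inord c.+1) X.
Proof.
move=> cp; apply/colP => a; rewrite !mxE (bigD1 (inord c.+1))//= big1 ?addr0.
  by rewrite JmxE !inordK ?eqxx ?mulr1// ltnS ltnW.
move=> l lc; rewrite JmxE inordK// eqSS andbC; case: eqP => [lE|_]; last by rewrite mulr0.
by case/eqP: lc; apply: val_inj; rewrite /= inordK// ltnS ltnW.
Qed.

Lemma col_Vmx0 (R : realType) n p (v : 'I_p.+1 -> 'cV[R[i]]_n) :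
  col ord0 (Vmx v) = v ord0.
Proof.
apply/colP => a; rewrite !mxE.
by case: splitP => b // _; rewrite ord1.
Qed.

Lemma col_VmxS (R : realType) n p (v : 'I_p.+1 -> 'cV[R[i]]_n) c : (c < p)%N ->
  col (inord c.+1) (Vmx v) = v (inord (p - c)).
Proof.
move=> cp; apply/colP => a; rewrite !mxE.
by case: splitP => b; rewrite inordK// ?ord1// => -[->]; rewrite mxE.
Qed.

(** * Identification of [F s] and evaluation of its columns *)

Theorem theorem1 (R : realType) (n p s : nat)
    (n_gt0 : (0 < n)%N) (p_gt0 : (0 < p)%N) (s_gt0 : (0 < s)%N)
    (A : 'M[R[i]]_n) (v : 'I_p.+1 -> 'cV[R[i]]_n)
    (D F : nat -> 'M[R[i]]_(n, 1 + p)) (S : 'M[R[i]]_(n, 1 + p))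
    (D1 : D 1%N = s%:R^-1 *: Vmx v)
    (DS : forall k : nat, (2 <= k)%N ->
       D k = (s%:R^-1 *: A) *m D k.-1 + D 1%N *m (s%:R^-1 *: Jmx R p) ^+ k.-1)
    (* the index is shifted by one so that the sum starts at k = 1 *)
    (SE : S = limn (series (fun k : nat => (k.+1`!)%:R^-1 *: D k.+1)))
    (F1 : F 1%N = S)
    (FS : forall k : nat, (1 <= k <= s - 1)%N ->
       F k.+1 = expmx (s%:R^-1 *: A) *m F k
                + S *m expmx ((k%:R / s%:R) *: Jmx R p)) :
  [/\ (* the series defining S converges *)
      series (fun k : nat => (k.+1`!)%:R^-1 *: D k.+1) @ \oo --> S,
      col ord0 (F s) = phimx 1 A *m v ord0,
      (* columns are counted from 1, hence the predecessor on the left *)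
      forall j : nat, (2 <= j <= p.+1)%N ->
        col (inord j.-1) (F s) =
          \sum_(1 <= k < j) phimx k A *m v (inord (p + k + 1 - j))
    & expmx A *m v ord0 = A *m col ord0 (F s) + v ord0].
Proof.
pose h : R[i] := s%:R^-1; pose J := Jmx R p; pose V := Vmx v.
pose M := block_mx A V 0 J.
have hM (a : R[i]) : a *: M = block_mx (a *: A) (a *: V) 0 (a *: J).
  by rewrite scale_block_mx scaler0.
have DE k : D k.+1 = ursubmx ((h *: M) ^+ k.+1).
  rewrite hM; elim: k => [|k IH].
    by rewrite ursubmx_block_exprS ursubmx_block_expr0 mulmx0 add0r expr0 mulmx1.
  by rewrite DS// D1 IH -ursubmx_block_exprS.
have cvS : series (fun k => (k.+1`!)%:R^-1 *: D k.+1) @ \oo --> ursubmx (expmx (h *: M)).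
  have -> : series (fun k => (k.+1`!)%:R^-1 *: D k.+1) =
      (fun N => series (fun k => (k`!)%:R^-1 *: ursubmx ((h *: M) ^+ k)) N.+1).
    apply/funext => N; rewrite /series/= big_nat_recl// hM.
    rewrite ursubmx_block_expr0 scaler0 add0r.
    by apply: eq_bigr => k _; rewrite DE hM.
  rewrite (cvg_shiftS (series (fun k => (k`!)%:R^-1 *: ursubmx ((h *: M) ^+ k)))).
  exact: cvg_ursubmx_expmx.
have SM : S = ursubmx (expmx (h *: M)) by rewrite SE; exact: norm_cvg_lim cvS.
have FE k : (k < s)%N -> F k.+1 = ursubmx (expmx ((k.+1%:R * h) *: M)).
  elim: k => [_|k IH ks]; first by rewrite F1 mul1r.
  (* Both summands are multiples of [M], hence commute, and the upper right block of the product of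
     their exponentials is the right-hand side of [FS]. *)
  have -> : (k.+2%:R * h) *: M = h *: M + (k.+1%:R * h) *: M.
    by rewrite -scalerDl -[in LHS]natr1 mulrDl mul1r addrC.
  rewrite expmxD; last by rewrite /comm_mx -!scalemxAl -!scalemxAr !scalerA mulrC.
  rewrite FS ?IH ?(ltnW ks)//; last by lia.
  rewrite SM !hM [in RHS]expmx_block_utri [X in _ = ursubmx (_ *m X)]expmx_block_utri.
  by rewrite mulmx_block block_mxKur.
have Fs : F s = ursubmx (expmx M).
  have sh : s%:R * h = 1 by rewrite divff// pnatr_eq0 -lt0n.
  have := FE s.-1; rewrite (prednK s_gt0) => ->; last exact: leqnn.
  congr (ursubmx (expmx _)).
  rewrite -[RHS]scale1r.
  congr (_ *: _).
  exact: sh.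
have UN k : ursubmx (M ^+ k.+1) = A ^+ k *m V + ursubmx (M ^+ k) *m J.
  exact: ursubmx_block_exprSr.
(* The upper right block of [M ^+ 0] is 0, so the exponential series starts at k = 1; reindexing
   gives weights 1/(k+1)!, the case q = 1 of [cvg_phimx_chain]. *)
have colU (j : 'I_(1 + p)) :
    series (fun k => ((k + 1)`!)%:R^-1 *: col j (ursubmx (M ^+ k.+1)))
      @ \oo --> col j (F s).
  have /cvg_mxP cF := cvg_ursubmx_expmx _ _ _ M; rewrite Fs.
  apply/cvg_mxP => a b; rewrite mxE; move: (cF a j); rewrite -cvg_shiftS.
  have -> // : (fun N => series (fun k => (k`!)%:R^-1 *: ursubmx (M ^+ k)) N.+1 a j) =
      (fun N => series (fun k => ((k + 1)`!)%:R^-1 *: col j (ursubmx (M ^+ k.+1))) N a b).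
  apply/funext => N; rewrite /series/= big_nat_recl//.
  rewrite ursubmx_block_expr0 scaler0 add0r !summxE.
  by apply: eq_bigr => k _; rewrite !mxE addn1.
have col0 : col ord0 (F s) = phimx 1 A *m v ord0.
  (* Column 0 receives nothing from other columns under [J], so it is a chain of length 1. *)
  have cw := @cvg_phimx_chain R n A (fun=> v ord0)
    (fun _ k => col ord0 (ursubmx (M ^+ k))) 1 _ _ _ 0 1 _.
  have := colU ord0 => /norm_cvg_lim <-.
  rewrite (norm_cvg_lim (cw _ _ _ _)) ?big_ord1// => [c|k].
    by rewrite ursubmx_block_expr0 raddf0.
  by rewrite UN raddfD /= col_mulmx_Jmx_eq0// addr0 colE -mulmxA -colE col_Vmx0.
split.
- by rewrite SM.
- exact: col0.
- move=> [//|[//|c]] /andP[_ cp].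
  (* The chain starts at column 1, where [V] carries v_p; its member [c] is column [c.+1], with
     source v_(p-c), and corresponds to j = c + 2. *)
  have cw := @cvg_phimx_chain R n A (fun c => v (inord (p - c)))
    (fun c k => col (inord c.+1) (ursubmx (M ^+ k))) p _ _ _ c 1 cp.
  rewrite -(norm_cvg_lim (colU _)) /= (norm_cvg_lim (cw _ _ _)).
  (* With k = l + 1 and j = c + 2, the index p + k + 1 - j equals p - (c - l), because l is at most
     c and c is below p. *)
  + rewrite big_add1 big_mkord; apply: eq_bigr => l _.
    rewrite add1n; congr (_ *m v (inord _)).
    by case: l => l /= lc; rewrite ltnS in cp; clear -lc cp; lia.
  + by move=> c'; rewrite ursubmx_block_expr0 raddf0.
  + move=> k; rewrite UN raddfD /= col_mulmx_Jmx_eq0 ?inordK// addr0.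
    by rewrite colE -mulmxA -colE col_VmxS ?subn0.
  + move=> c' k c'p; rewrite UN raddfD /= col_mulmx_Jmx//; congr (_ + _).
    by rewrite colE -mulmxA -colE col_VmxS.
- by rewrite expmxE mulmxDl mul1mx -mulmxA col0.
Qed.
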